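(* Let $G$ be a DAG on $X$ that satisfies (PCC), and let $\mathcal{I}\subseteq\{1,\dots,|X|\}$ with $1\in\mathcal{I}$. Then $G$ has the $\mathcal{I}$-lca-property if and only if $\mathfrak{C}_G$ is pre-$\mathcal{I}$-ary.
   Context: All sets are finite. A directed graph $G=(V,E)$ has a nonempty vertex set and edge set $E\subseteq (V\times V)\setminus\{(v,v)\mid v\in V\}$. A DAG is a directed graph without directed cycles. For a DAG $G$, write $v\preceq_G w$ if there is a directed path (possibly of length $0$) from $w$ to $v$; then $w$ is an ancestor of $v$. $L(G)$ denotes the set of leaves (vertices with no outgoing edges); $G$ is a DAG on $X$ if $L(G)=X$. Clusters: $\mathtt{C}_G(v)=\{x\in L(G)\mid x\preceq_G v\}$ and $\mathfrak{C}_G=\{\mathtt{C}_G(v)\mid v\in V(G)\}$. $G$ satisfies (PCC), the path-cluster-comparability property, if for all $u,v\in V(G)$: $u$ and $v$ are $\preceq_G$-comparable if and only if $\mathtt{C}_G(u)\subseteq\mathtt{C}_G(v)$ or $\mathtt{C}_G(v)\subseteq\mathtt{C}_G(u)$. For $\emptyset\neq A\subseteq L(G)$, $\mathrm{LCA}_G(A)$ is the set of $\preceq_G$-minimal vertices among those that are ancestors of all elements of $A$. $\mathrm{lca}_G(A)$ is well-defined if $|\mathrm{LCA}_G(A)|=1$. $X(\mathcal{I})$ is the set of all $A\subseteq X$ with $|A|\in\mathcal{I}$. $G$ has the $\mathcal{I}$-lca-property if $\mathrm{lca}_G(A)$ is well-defined for all $A\in X(\mathcal{I})$. A set system $\mathfrak{C}$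 on $X$ (a collection of subsets of $X$) is pre-$\mathcal{I}$-ary if for all $A\in X(\mathcal{I})$ there is a unique inclusion-minimal $C\in\mathfrak{C}$ with $A\subseteq C$. *)

(* Defs.v *)
From mathcomp Require Import all_boot.

Set Implicit Arguments.
Unset Strict Implicit.
Unset Printing Implicit Defensive.

Record digraph := Digraph {
  vertex :> finType;
  edge : rel vertex;
  edge_irr : irreflexive edge;
  vertex_gt0 : 0 < #|vertex|
}.

(* [ucycle] compels distinct vertices but allows the empty cycle, which is
   the only one not excluded here. *)
Definition acyclic (G : digraph) : Prop :=
  forall c : seq G, ucycle (@edge G) c -> c = [::].

(* Descendants are below ancestors: there is a path from w down to v. *)
Definition preceq (G : digraph) : rel G := fun v w => connect (@edge G) w v.

Definition leaves (G : digraph) : {set G} :=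
  [set v : G | ~~ [exists w : G, edge v w]].

Definition dag_on (G : digraph) (X : {set G}) : Prop :=
  acyclic G /\ leaves G = X.

Definition cluster (G : digraph) (v : G) : {set G} :=
  [set x in leaves G | preceq x v].

Definition clusters (G : digraph) : {set {set G}} :=
  [set cluster v | v : G].

Definition PCC (G : digraph) : Prop :=
  forall u v : G,
    preceq u v || preceq v u <->
    (cluster u \subset cluster v) || (cluster v \subset cluster u).

Definition common_ancestors (G : digraph) (A : {set G}) : {set G} :=
  [set v : G | [forall x in A, preceq x v]].

Definition LCA (G : digraph) (A : {set G}) : {set G} :=
  [set v in common_ancestors A |
     [forall w in common_ancestors A, preceq w v ==> (w == v)]].

Definition lca_well_defined (G : digraph) (A : {set G}) : Prop :=
  #|LCA A| = 1.

(* X(I): the subsets of X whose cardinality lies in I. *)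
Definition subsets_sized (T : finType) (X : {set T}) (I : {pred nat}) :
    {set {set T}} :=
  [set A in powerset X | #|A| \in I].

Definition lca_property (G : digraph) (I : {pred nat}) : Prop :=
  forall A : {set G}, A \in subsets_sized (leaves G) I -> lca_well_defined A.

Definition pre_ary (T : finType) (X : {set T}) (I : {pred nat})
    (CC : {set {set T}}) : Prop :=
  forall A : {set T}, A \in subsets_sized X I ->
    exists! C : {set T}, minset [pred D in CC | A \subset D] C.

(* [pre_ary] is meant for set systems on X; clusters form one on the leaves. *)
Lemma clusters_on_leaves (G : digraph) : clusters G \subset powerset (leaves G).
Proof.
apply/subsetP=> _ /imsetP[v _ ->]; rewrite powersetE.
by apply/subsetP=> x; rewrite inE => /andP[].
Qed.

(* Main.v *)
(** A common ancestor of a set A of leaves is a vertex whose cluster contains A.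
    Below every common ancestor lies a minimal one.  If the minimal one is
    unique, it lies below all the others, so its cluster is the least one
    containing A.  Conversely, if C is the only minimal cluster containing A,
    some minimal common ancestor v has cluster C; any other one has a cluster
    containing C, hence is comparable to v by (PCC), hence equals v. *)
Require Import Defs.
From mathcomp Require Import all_boot.

Set Implicit Arguments.
Unset Strict Implicit.
Unset Printing Implicit Defensive.

(** A path back from [x] to [u], once shortened to be duplicate-free, closes up with the edge into a
    nonempty [ucycle]. *)
Lemma acyclic_no_return (G : digraph) (u x : G) :
  acyclic G -> edge u x -> ~~ connect (@edge G) x u.
Proof.
move=> acG ux; apply/negP=> /connectP[p xp lastp].
case/shortenP: xp lastp => q xq uniq_xq _ last_u.
suff /acG : ucycle (@edge G) (x :: q) by [].
by rewrite /ucycle uniq_xq /= rcons_path xq -last_u ux.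
Qed.

Lemma acyclic_preceq_anti (G : digraph) :
  acyclic G -> antisymmetric (@preceq G).
Proof.
(* A nonempty path from [u] to [v] starts with an edge to some [x], from which [u] is reached again
   through [v]. *)
move=> acG v u /andP[/connectP[[|x p] /= path_p last_p] vu] //.
case/andP: path_p => ux xp.
have xv : connect (@edge G) x v by apply/connectP; exists p.
by have := acyclic_no_return acG ux; rewrite (connect_trans xv vu).
Qed.

Lemma preceq_cluster (G : digraph) (u v : G) :
  preceq u v -> cluster u \subset cluster v.
Proof.
move=> uv; apply/subsetP=> x; rewrite !inE => /andP[-> xu] /=.
exact: connect_trans uv xu.
Qed.

Lemma common_ancestors_cluster (G : digraph) (A : {set G}) (v : G) :
  A \subset leaves G -> (v \in common_ancestors A) = (A \subset cluster v).
Proof.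
move=> AL; rewrite inE; apply/'forall_implyP/subsetP => [Av x xA | Av x xA].
  by rewrite inE (subsetP AL) // Av.
by have := Av x xA; rewrite inE => /andP[].
Qed.

Lemma LCAP (G : digraph) (A : {set G}) (v : G) :
  reflect (v \in common_ancestors A /\
           {in common_ancestors A, forall w, preceq w v -> w = v})
          (v \in LCA A).
Proof.
rewrite /LCA in_set; apply: (iffP andP) => -[vA minv]; split=> //.
  by move=> w wA wv; apply/eqP; move/'forall_implyP/(_ w wA)/implyP: minv; apply.
by apply/'forall_implyP=> w wA; apply/implyP=> wv; apply/eqP/minv.
Qed.

(** Among the common ancestors below [w], one with the fewest descendants is minimal: a common
    ancestor [u] below it has no fewer descendants, hence the same ones, so each lies below the
    other. *)
Lemma LCA_below (G : digraph) (A : {set G}) (w : G) :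
  acyclic G -> w \in common_ancestors A -> exists2 v, v \in LCA A & preceq v w.
Proof.
move=> acG wA.
have ww : (w \in common_ancestors A) && preceq w w by rewrite wA /preceq connect0.
case: (@arg_minnP _ w [pred v | (v \in common_ancestors A) && preceq v w]
         (fun v => #|[set x | preceq x v]|) ww).
move=> v /andP[vA vw] minv; exists v => //; apply/LCAP; split=> // u uA uv.
apply: acyclic_preceq_anti acG _ _ _; rewrite uv /=.
have sub_uv : [set x | preceq x u] \subset [set x | preceq x v].
  by apply/subsetP=> x; rewrite !inE; apply: connect_trans.
have uw : preceq u w by apply: connect_trans vw uv.
have le_vu := minv u; rewrite /= uA uw in le_vu.
have /eqP eq_uv : [set x | preceq x u] == [set x | preceq x v].
  by rewrite eqEcard sub_uv le_vu.
by move/setP/(_ v): eq_uv; rewrite !inE => ->; rewrite /preceq connect0.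
Qed.

Lemma clusters_minset_lca (G : digraph) (A : {set G}) :
  acyclic G -> A \subset leaves G -> lca_well_defined A ->
  exists! C : {set G}, minset [pred D in clusters G | A \subset D] C.
Proof.
move=> acG AL /eqP/cards1P[v LCAv].
have vA : v \in common_ancestors A.
  by have /LCAP[] : v \in LCA A by rewrite LCAv set11.
(* [D] is the cluster of a common ancestor, and the minimal one below that can only be [v]. *)
have least D : D \in clusters G -> A \subset D -> cluster v \subset D.
  case/imsetP=> w _ -> Aw.
  have [|u] := @LCA_below G A w acG; first by rewrite common_ancestors_cluster.
  by rewrite LCAv => /set1P-> /preceq_cluster.
have vC : (cluster v \in clusters G) && (A \subset cluster v).
  by rewrite imset_f // -common_ancestors_cluster.
exists (cluster v); split.
  apply/minsetP; split=> // D /andP[DC AD] Dv.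
  by apply/eqP; rewrite eqEsubset Dv least.
by move=> D /minsetP[/andP[DC AD] minD]; apply: minD => //; apply: least.
Qed.

Lemma lca_clusters_minset (G : digraph) (A : {set G}) :
  acyclic G -> PCC G -> A \subset leaves G ->
  (exists! C : {set G}, minset [pred D in clusters G | A \subset D] C) ->
  lca_well_defined A.
Proof.
move=> acG pccG AL [C [/minsetP[/andP[/imsetP[w _ ->] Aw] minC] uniqC]].
have [|v vL vw] := @LCA_below G A w acG; first by rewrite common_ancestors_cluster.
have [vA minv] := LCAP _ _ vL.
have vC : cluster v = cluster w.
  apply: minC (preceq_cluster vw).
  by rewrite inE imset_f // -common_ancestors_cluster.
apply/eqP/cards1P; exists v; apply/setP=> u; rewrite in_set1.
apply/idP/eqP=> [/LCAP[uA minu] | ->//].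
have uC : (cluster u \in clusters G) && (A \subset cluster u).
  by rewrite imset_f // -common_ancestors_cluster.
(* By finiteness [cluster u] contains a minimal cluster around [A], which by uniqueness is
   [cluster w], that is, [cluster v]. *)
have [D minD Du] := minset_exists (P := [pred D in clusters G | A \subset D]) uC.
have vu : cluster v \subset cluster u.
  by rewrite vC; move: Du; rewrite -[D]uniqC // minC.
(* Both [u] and [v] are minimal, so comparability in either direction makes them equal. *)
have /(pccG v u)/orP[|] : (cluster v \subset cluster u) || (cluster u \subset cluster v).
  by rewrite vu.
  by move/(minu v vA).
by move/(minv u uA).
Qed.

Theorem theorem3p5 (G : digraph) (X : {set G}) (I : {pred nat}) :
  dag_on X ->
  PCC G ->
  (forall i : nat, i \in I -> 1 <= i <= #|X|) ->
  1 \in I ->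
  lca_property G I <-> pre_ary X I (clusters G).
Proof.
move=> [acG <-] pccG _ _; split=> H A AI; have := AI.
  rewrite in_set powersetE => /andP[AL _].
  exact: clusters_minset_lca acG AL (H A AI).
rewrite in_set powersetE => /andP[AL _].
exact: lca_clusters_minset acG pccG AL (H A AI).
Qed.
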